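(* Let players $1,\dots,n$ have positive values $v_1,\dots,v_n$, where $n = 2^s + k$ with integers $s\ge1$ and $0\le k<2^s$, and for each $i$ let $p_i = \frac{1}{n-1}\sum_{j\ne i}\frac{v_i}{v_i+v_j}$. Then, for every tournament format and every $i\in\{1,\dots,n\}$, $$P_i \leq \begin{cases} \left(\frac{2k}{n}p_i + 1 - \frac{2k}{n}\right)p_i^s & \text{if } p_i > \frac12,\\[2mm] \frac1n & \text{if } p_i = \frac12,\\[2mm] \prod_{j=1}^{n-1}\left(\frac{2}{n-j+1}p_i + 1 - \frac{2}{n-j+1}\right) & \text{if } p_i < \frac12.\end{cases}$$
   Context: Random knockout tournament: there are $n\ge 2$ players $1,\dots,n$ with positive values $v_1,\dots,v_n$. A format is a tuple $(r,m_1,\dots,m_r)$ of positive integers with $\sum_{s=1}^r m_s = n-1$ and $2m_s \le r_s$ for each $s$, where $r_s = n-\sum_{j=1}^{s-1} m_j$ is the number of players still alive (not eliminated) at the start of round $s$. In round $s$, independently of the past given the set of alive players, $2m_s$ of the $r_s$ alive players are chosen uniformly at random and are uniformly randomly arranged into $m_s$ match pairs. A match between $i$ and $j$ is won by $i$ with probability $v_i/(v_i+v_j)$, independently of everything else. Losers are eliminated; the winners and the alive players not chosen to play advance to the next round. After round $r$ exactly one player remains, the winner of the tournament. $P_i$ denotes the probability that player $i$ wins the tournament. *)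

(* Defs.v *)
From HB Require Import structures.
From mathcomp Require Import all_boot all_order all_algebra.
From mathcomp Require Import reals.
Set Implicit Arguments.
Unset Strict Implicit.
Unset Printing Implicit Defensive.
Import Order.TTheory GRing.Theory Num.Theory.
Local Open Scope ring_scope.

(* ms lists the numbers of matches of the successive rounds; n - sumn (take s ms)
   players are still alive before the matches counted by nth 0 ms s. *)
Definition is_format (n : nat) (ms : seq nat) : Prop :=
  [/\ (0 < size ms)%N,
      forall s, (s < size ms)%N -> (0 < nth 0%N ms s)%N,
      sumn ms = (n - 1)%N &
      forall s, (s < size ms)%N ->
        (2 * nth 0%N ms s <= n - sumn (take s ms))%N].

Definition uniform_pr (R : realType) (T : finType) (D : {set T}) (x : T) : R :=
  if x \in D then (#|D|%:R)^-1 else 0.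

Definition beat_pr (R : realType) (n : nat) (v : 'I_n -> R) (i j : 'I_n) : R :=
  v i / (v i + v j).

Definition selections (n m : nat) (A : {set 'I_n}) : {set {set 'I_n}} :=
  [set S : {set 'I_n} | (S \subset A) && (#|S| == 2 * m)%N].

(* Match j is played between f (j, false) and f (j, true).  Each set of m
   unordered pairs partitioning S comes from the same number, m! * 2^m, of such
   bijections f, so a uniform f gives a uniform pairing. *)
Definition arrangements (n m : nat) (S : {set 'I_n}) :
    {set {ffun 'I_m * bool -> 'I_n}} :=
  [set f : {ffun 'I_m * bool -> 'I_n} |
     injectiveb f && ([set f x | x in setT] == S)].

(* w j is the winning side of match j. *)
Definition outcome_pr (R : realType) (n m : nat) (v : 'I_n -> R)
    (f : {ffun 'I_m * bool -> 'I_n}) (w : {ffun 'I_m -> bool}) : R :=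
  \prod_(j < m) beat_pr v (f (j, w j)) (f (j, ~~ w j)).

Definition survivors (n m : nat) (A : {set 'I_n})
    (f : {ffun 'I_m * bool -> 'I_n}) (w : {ffun 'I_m -> bool}) : {set 'I_n} :=
  A :\: [set f (j, ~~ w j) | j : 'I_m].

(* Probability that B is the set of alive players after a round of m matches
   started with A alive. *)
Definition round_pr (R : realType) (n : nat) (v : 'I_n -> R) (m : nat)
    (A B : {set 'I_n}) : R :=
  \sum_(S : {set 'I_n}) uniform_pr R (selections m A) S *
    \sum_(f : {ffun 'I_m * bool -> 'I_n}) uniform_pr R (arrangements m S) f *
      \sum_(w : {ffun 'I_m -> bool} | survivors A f w == B) outcome_pr v f w.

(* The set of alive players is a Markov chain with kernels round_pr;
   win_from v ms A i is the probability that it goes from A to {i} in the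
   successive rounds ms. *)
Fixpoint win_from (R : realType) (n : nat) (v : 'I_n -> R) (ms : seq nat)
    (A : {set 'I_n}) (i : 'I_n) : R :=
  if ms is m :: ms' then
    \sum_(B : {set 'I_n}) round_pr v m A B * win_from v ms' B i
  else (A == [set i])%:R.

Definition win_pr (R : realType) (n : nat) (v : 'I_n -> R) (ms : seq nat)
    (i : 'I_n) : R := win_from v ms setT i.

Definition mean_beat_pr (R : realType) (n : nat) (v : 'I_n -> R) (i : 'I_n) : R :=
  1 / (n - 1)%:R * \sum_(j < n | j != i) beat_pr v i j.

(* Main.v *)
Require Import Defs.
From HB Require Import structures.
From mathcomp Require Import all_boot all_order all_algebra.
From mathcomp Require Import reals.
From mathcomp Require Import fingroup perm zify ring lra.
Import Order.TTheory GRing.Theory Num.Theory.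
Local Open Scope ring_scope.
Set Implicit Arguments.
Unset Strict Implicit.
Unset Printing Implicit Defensive.

(** Fix a player i and put x_l = v_i / (v_i + v_l), the probability that i beats
    l.  If the opponents of i were always uniform among the players alive, i
    would win a tournament in which it plays d matches with probability a_d(X),
    the mean of the product of the x_l over the d-element subsets of the set X
    of its n - 1 opponents.  Maclaurin's inequality [elem_mean_le_exp] bounds
    this by a_1(X)^d = p^d.  In a round of m matches among r players, i plays
    with probability 2m/r, so averaging p^d over the number d of its matches
    gives the product over the rounds of 1 - (2m/r)(1 - p), called
    [round_factors] below.

    The true opponents are not uniform: the survivors of a round are biased
    towards strong players, that is, towards small x_l.  This bias can only hurt
    i, because the chance of i against uniform opponents increases with each
    x_l.  Precisely ([round_surv_mean_le]), one round maps the mean of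
    a_d(opponents of i), counted as zero when i is eliminated, to at most
    (1 - 2m/r) a_d + (2m/r) a_{d+1}.  In the proof, the law of the pairing is
    invariant under every permutation of the players alive, so one may fix the
    pairing and the winning sides and average over the permutation s that places
    the players in these slots.  Exchanging the two players of a match that does
    not involve i shows that its factor may be replaced by 1/2
    ([sum_beats_le]): the slot of the winner contributes a larger x exactly when
    the winner is the weaker of the two.  Once all these factors are 1/2, the
    average over s is a_d, or a_{d+1} when i plays, the extra factor x
    being that of the opponent of i ([sum_prod_perm]).  Iterating over the
    rounds gives [win_from_le_factors], valid for every value of p.

    It remains to maximise [round_factors] over the formats.  Merging two rounds
    into one multiplies out to a comparison whose sign is that of 2p - 1.  For
    p < 1/2 the worst case is one match per round; for p = 1/2 the factors
    telescope to 1/n; for p > 1/2 the worst case plays k matches first and then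
    halves the 2^s remaining players in each round. *)

(** * Normalised elementary symmetric means *)

Section Means.
Variables (R : realFieldType) (T : finType).
Implicit Types (x : T -> R) (X Y D : {set T}) (G : {set {perm T}}).

Definition elem_mean x (d : nat) X : R :=
  (\sum_(D : {set T} | (D \subset X) && (#|D| == d)) \prod_(l in D) x l)
    / 'C(#|X|, d)%:R.

(** Closure under precomposition with transpositions of Y: the symmetry that lets
    a sum over G forget which points of Y are singled out.  A group is not
    required, so that cosets such as the permutations of Y with one prescribed
    value qualify. *)
Definition swap_closed Y G : Prop :=
  forall a b s, a \in Y -> b \in Y -> s \in G -> (tperm a b * s)%g \in G.

Lemma sum_swap Y G a b (F : {perm T} -> R) :
  swap_closed Y G -> a \in Y -> b \in Y ->
  \sum_(s in G) F (tperm a b * s)%g = \sum_(s in G) F s.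
Proof.
move=> GY aY bY.
rewrite [RHS](reindex_inj (mulgI (tperm a b))) /=.
apply: eq_bigl => s; apply/idP/idP => [|sG]; first exact: GY.
by have := GY a b _ aY bY sG; rewrite mulgA tperm2 mul1g.
Qed.

Definition stab X : {set {perm T}} := [set s : {perm T} | [set s l | l in X] == X].

Lemma stabP X s : s \in stab X -> [set s l | l in X] = X.
Proof. by rewrite inE => /eqP. Qed.

Lemma stab_mem X (s : {perm T}) l : s \in stab X -> (s l \in X) = (l \in X).
Proof. by move=> /stabP {1}<-; rewrite mem_imset //; apply: perm_inj. Qed.

Lemma stab_swap X : swap_closed X (stab X).
Proof.
move=> a c s aX cX sX; rewrite inE; apply/eqP/setP => l.
have tX k : (tperm a c k \in X) = (k \in X).
  by case: tpermP => [->|->|]; rewrite ?aX ?cX.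
rewrite -(permKV (tperm a c * s)%g l) mem_imset; last exact: perm_inj.
by rewrite permM (stab_mem _ sX) tX.
Qed.

Lemma card_stab_gt0 X : (0 < #|stab X|)%N.
Proof.
apply/card_gt0P; exists 1%g; rewrite inE; apply/eqP.
by rewrite -[RHS]imset_id; apply: eq_imset => l; rewrite perm1.
Qed.

(** Two subsets of equal size are joined by a chain of transpositions, each of
    which brings D closer to D'. *)
Lemma sum_prod_perm_indep Y G x D D' :
  swap_closed Y G -> D \subset Y -> D' \subset Y -> #|D| = #|D'| ->
  \sum_(s in G) \prod_(l in D) x (s l) = \sum_(s in G) \prod_(l in D') x (s l).
Proof.
move=> GY; have [m] := ubnP #|D :\: D'|; elim: m D => // m IHm D ltm DY D'Y cD.
have [sDD'|/subsetPn[a aD aD']] := boolP (D \subset D').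
  by have -> : D = D' by apply/eqP; rewrite eqEcard sDD' cD leqnn.
have /subsetPn[b bD' bD] : ~~ (D' \subset D).
  apply: contra aD' => sD'D.
  by have -> : D' = D by apply/eqP; rewrite eqEcard sD'D cD leqnn.
have aY := subsetP DY _ aD; have bY := subsetP D'Y _ bD'.
have E : [set tperm a b l | l in D] = b |: D :\ a.
  apply/setP => l; rewrite -{1}(tpermK a b l) mem_imset ?inE; last exact: perm_inj.
  case: tpermP => [->|->|/eqP/negPf -> /eqP/negPf ->] //.
  - by rewrite (negPf bD) eqxx orbF; apply/esym/eqP => eab; rewrite -eab aD in bD.
  - by rewrite eqxx.
rewrite -(sum_swap (fun s => \prod_(l in D) x (s l)) GY aY bY).
rewrite (eq_bigr (fun s : {perm T} => \prod_(l in b |: D :\ a) x (s l))); last first.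
  move=> s _; rewrite -E big_imset /=; last by move=> ? ? _ _; apply: perm_inj.
  by apply: eq_bigr => l _; rewrite permM.
apply: IHm => //.
- rewrite setDUl; have -> : [set b] :\: D' = set0.
    by apply/setP=> l; rewrite !inE; case: eqP => [->|]; rewrite ?bD' ?andbF.
  rewrite set0U; apply: leq_trans (_ : #|D :\: D'| <= _)%N; last by [].
  apply: proper_card; apply/properP; split.
    by apply/subsetP => l; rewrite !inE => /and3P[-> _ ->].
  by exists a; rewrite !inE ?aD ?aD' ?eqxx.
- apply/subsetP => l; rewrite !inE => /orP[/eqP -> //|/andP[_]]; exact: subsetP.
- by rewrite cardsU1 !inE (negPf bD) andbF /= -cD (cardsD1 a D) aD.
Qed.

Lemma elem_sum_imset x (s : {perm T}) d X :
  \sum_(D : {set T} | (D \subset [set s l | l in X]) && (#|D| == d))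
     \prod_(l in D) x l =
  \sum_(D : {set T} | (D \subset X) && (#|D| == d)) \prod_(l in D) x (s l).
Proof.
rewrite (reindex_onto (fun E : {set T} => s @: E)
  (fun E : {set T} => s @^-1: E)) /=; last first.
  move=> E _; apply/setP => l; rewrite -(permKV s l) mem_imset ?inE //.
  exact: perm_inj.
apply: eq_big => [E|E _]; last by rewrite big_imset //= => ? ? _ _; apply: perm_inj.
have -> : s @^-1: (s @: E) = E.
  by apply/setP => l; rewrite inE mem_imset //; apply: perm_inj.
rewrite eqxx andbT card_imset; last exact: perm_inj.
congr (_ && _); apply/idP/idP => [/subsetP sE|/(imsetS s) //].
apply/subsetP => l lE; rewrite -(mem_imset X l (@perm_inj _ s)).
by apply/sE/imset_f.
Qed.

Lemma elem_mean_imset x (s : {perm T}) d X :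
  elem_mean x d [set s l | l in X] = elem_mean (fun l => x (s l)) d X.
Proof.
rewrite /elem_mean elem_sum_imset card_imset //; exact: perm_inj.
Qed.

(** By symmetry the sum depends on D only through its size; averaging it over all D
    of that size turns each permutation's contribution into the full symmetric
    sum over X. *)
Lemma sum_prod_perm X Y G x D :
  swap_closed Y G -> (forall s, s \in G -> [set s l | l in Y] = X) ->
  D \subset Y ->
  \sum_(s in G) \prod_(l in D) x (s l) = #|G|%:R * elem_mean x #|D| X.
Proof.
move=> GY GX DY; have [->|[s0 s0G]] := set_0Vmem G.
  by rewrite big_set0 cards0 mul0r.
have cXY : #|X| = #|Y| by rewrite -(GX _ s0G) card_imset //; apply: perm_inj.
have C0 : 'C(#|X|, #|D|)%:R != 0 :> R.
  by rewrite pnatr_eq0 -lt0n bin_gt0 cXY subset_leq_card.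
rewrite /elem_mean mulrA; apply: (canRL (mulfK C0)).
transitivity (\sum_(E : {set T} | (E \subset Y) && (#|E| == #|D|))
                \sum_(s in G) \prod_(l in E) x (s l)).
  rewrite [RHS](eq_bigr (fun=> \sum_(s in G) \prod_(l in D) x (s l))); last first.
    by move=> E /andP[EY /eqP cE]; apply: sum_prod_perm_indep GY _ _ _.
  rewrite sumr_const mulr_natr; congr (_ *+ _).
  by rewrite cXY -cards_draws; apply: eq_card => E; rewrite !inE.
rewrite exchange_big /= mulr_natl -sumr_const; apply: eq_bigr => s sG.
by rewrite -(GX _ sG) elem_sum_imset.
Qed.

Lemma elem_mean_ge0 x d X : (forall l, 0 <= x l) -> 0 <= elem_mean x d X.
Proof.
move=> x0; apply: divr_ge0 => //.
by apply: sumr_ge0 => D _; apply: prodr_ge0.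
Qed.

Lemma elem_mean0 x X : elem_mean x 0 X = 1.
Proof.
rewrite /elem_mean bin0 divr1 (big_pred1 set0) ?big_set0 // => D /=.
rewrite cards_eq0; apply/andP/eqP => [[_ /eqP]//|->]; by rewrite sub0set eqxx.
Qed.

Lemma elem_mean1 x X : elem_mean x 1 X = (\sum_(l in X) x l) / #|X|%:R.
Proof.
rewrite /elem_mean bin1; congr (_ / _).
rewrite (eq_bigl (fun D : {set T} => D \in [set [set l] | l in X])); last first.
  move=> D; apply/andP/imsetP => [[DX /cards1P[l Dl]]|[l lX ->]].
    by exists l => //; rewrite Dl sub1set in DX.
  by rewrite sub1set lX cards1.
rewrite big_imset /=; last by move=> l l' _ _; apply: set1_inj.
by apply: eq_bigr => l _; rewrite big_set1.
Qed.

Lemma elem_mean_gt_card x d X : (#|X| < d)%N -> elem_mean x d X = 0.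
Proof. by move=> lt; rewrite /elem_mean bin_small // invr0 mulr0. Qed.

(** Averaging over the permutations s of X, with D a d-subset and l0 outside D,
    the left side is the mean of x_(s D) x_(s l0).  Replacing l0 by a point l of
    D only increases it, since the mean of x_(s l) x_(s l0) times a common
    factor is at most that of x_(s l)^2 (arithmetic-geometric mean inequality and
    symmetry).  So the left side is at most the mean over all l in X, which is
    the right side. *)
Lemma elem_meanS x d X : (forall l, 0 <= x l) ->
  elem_mean x d.+1 X <= elem_mean x d X * elem_mean x 1 X.
Proof.
move=> x0; have [ltX|leX] := ltnP #|X| d.+1.
  by rewrite elem_mean_gt_card // mulr_ge0 ?elem_mean_ge0.
pose G := stab X.
have GX s : s \in G -> [set s l | l in X] = X by exact: stabP.
have Gs : swap_closed X G by exact: stab_swap.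
have G0 : 0 < #|G|%:R :> R by rewrite ltr0n card_stab_gt0.
have [D DX cD] : exists2 D : {set T}, D \subset X & #|D| = d.
  have : (0 < #|[set D : {set T} | D \subset X & #|D| == d]|)%N.
    by rewrite cards_draws bin_gt0 ltnW.
  by case/card_gt0P => D; rewrite inE => /andP[? /eqP]; exists D.
(* M l is the mean (up to #|G|) of x_(s D) x_(s l), constant for l outside D,
   and at least that constant for l in D. *)
pose M l := \sum_(s in G) (\prod_(j in D) x (s j)) * x (s l).
have MD l : l \in X -> l \notin D -> M l = #|G|%:R * elem_mean x d.+1 X.
  move=> lX lD; rewrite -cD.
  have -> : #|D|.+1 = #|l |: D| by rewrite cardsU1 lD.
  rewrite -(sum_prod_perm _ Gs GX).
    by apply: eq_bigr => s _; rewrite big_setU1 //= mulrC.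
  by rewrite subUset sub1set lX.
have [l0 l0X l0D] : exists2 l, l \in X & l \notin D.
  by apply/subsetPn; apply/negP => /subset_leq_card; rewrite cD leqNgt leX.
have leM l : l \in X -> #|G|%:R * elem_mean x d.+1 X <= M l.
  move=> lX; have [lD|] := boolP (l \in D); last by move=> /(MD _ lX) ->.
  rewrite -(MD _ l0X l0D).
  pose H s := \prod_(j in D :\ l) x (s j).
  have H0 s : 0 <= H s by apply: prodr_ge0.
  have E1 : M l = \sum_(s in G) H s * x (s l) ^+ 2.
    apply: eq_bigr => s _; rewrite (big_setD1 l) //= -/(H s); ring.
  have E2 : M l = \sum_(s in G) H s * x (s l0) ^+ 2.
    rewrite E1 -(sum_swap _ Gs lX l0X); apply: eq_bigr => s _.
    rewrite permM tpermL; congr (_ * _); apply: eq_bigr => j.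
    rewrite !inE permM => /andP[jl jD]; rewrite tpermD //; first by rewrite eq_sym.
    by apply: contraNneq l0D => ->.
  have -> : M l = \sum_(s in G) H s * ((x (s l) ^+ 2 + x (s l0) ^+ 2) / 2).
    have -> : M l = (M l + M l) / 2 by lra.
    rewrite {1}E1 E2 -big_split mulr_suml.
    by apply: eq_bigr => s _ /=; ring.
  apply: ler_sum => s _; rewrite (big_setD1 l) //= -/(H s).
  rewrite (mulrC (x (s l))) -mulrA ler_wpM2l //.
  have := sqr_ge0 (x (s l) - x (s l0)); lra.
have X0 : 0 < #|X|%:R :> R by rewrite ltr0n (leq_trans _ leX).
rewrite -(ler_pM2l G0) -(ler_pM2r X0).
apply: le_trans (_ : \sum_(l in X) M l <= _).
  by rewrite mulr_natr -sumr_const; apply: ler_sum => l /leM.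
rewrite elem_mean1 (mulrA #|G|%:R) -(mulrA (_ * _)) divfK ?gt_eqF //.
have := sum_prod_perm x Gs GX DX; rewrite cD => <-.
rewrite exchange_big mulr_suml /=.
rewrite le_eqVlt; apply/orP; left; apply/eqP; apply: eq_bigr => s sG.
rewrite -mulr_sumr -{2}(GX s sG) [in RHS]big_imset //= => ? ? _ _; exact: perm_inj.
Qed.

(** Maclaurin's inequality, in the only form needed: against the first mean. *)
Lemma elem_mean_le_exp x d X : (forall l, 0 <= x l) ->
  elem_mean x d X <= elem_mean x 1 X ^+ d.
Proof.
move=> x0; elim: d => [|d IHd]; first by rewrite elem_mean0 expr0.
rewrite exprSr (le_trans (elem_meanS _ _ x0)) // ler_wpM2r //.
exact: elem_mean_ge0.
Qed.

(** When d exceeds the size of X, the quotient is 0 / 0 = 0, whence the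
    assumption on the sign of K. *)
Lemma elem_average_le (h : {set T} -> R) X d (K : R) :
  0 <= K ->
  (forall D, D \subset X -> #|D| = d -> h D <= K) ->
  (\sum_(D : {set T} | (D \subset X) && (#|D| == d)) h D) / 'C(#|X|, d)%:R <= K.
Proof.
move=> K0 hK; have [C0|C0] := eqVneq 'C(#|X|, d) 0%N.
  by rewrite C0 invr0 mulr0.
rewrite ler_pdivrMr ?ltr0n ?lt0n // mulr_natr -cards_draws -sumr_const.
rewrite [leRHS](eq_bigl (fun D : {set T} => (D \subset X) && (#|D| == d))).
  by apply: ler_sum => D /andP[DX /eqP]; apply: hK.
by move=> D; rewrite inE.
Qed.

End Means.

(** * Optimising the format *)

Section Formats.
Variable R : realFieldType.
Implicit Types (p : R) (m r s k : nat) (ms : seq nat).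

Fixpoint feasible (r : nat) (ms : seq nat) : bool :=
  if ms is m :: ms' then (2 * m <= r)%N && feasible (r - m) ms' else true.

Lemma play_pr_ge0 (m r : nat) : 0 <= (2 * m)%:R / r%:R :> R.
Proof. by rewrite divr_ge0 ?ler0n. Qed.

Lemma play_pr_le1 (m r : nat) : (2 * m <= r)%N -> 0 <= 1 - (2 * m)%:R / r%:R :> R.
Proof.
case: r => [|r mr]; first by rewrite invr0 mulr0 subr0.
by rewrite subr_ge0 ler_pdivrMr ?ltr0n // mul1r ler_nat.
Qed.

(** The probability that a player wins all its matches when it wins each of them
    with probability p and independently plays with probability 2m/r in a round
    of m matches among r players. *)
Fixpoint round_factors (ms : seq nat) (r : nat) (p : R) : R :=
  if ms is m :: ms' then
    (1 - (2 * m)%:R / r%:R * (1 - p)) * round_factors ms' (r - m) p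
  else 1.

Lemma round_factor_ge0 m r p : 0 <= p -> p <= 1 -> (2 * m <= r)%N ->
  0 <= 1 - (2 * m)%:R / r%:R * (1 - p).
Proof.
move=> p0 p1 mr; have := play_pr_le1 mr; have := play_pr_ge0 m r.
set q := _ / _ => q0 q1; nra.
Qed.

(** Splitting a round into single matches increases the product: with q = 1 - p,
    replacing a round of m + 1 matches among t players by a round of m matches and
    a single match adds 2 q m (2q - 1) / (t (t - m)) to its factor, which is
    nonnegative for q >= 1/2. *)
Lemma round_factors_le_single ms r p : 0 <= p -> p <= 1 / 2 -> (0 < r)%N ->
  feasible r ms -> sumn ms = (r - 1)%N ->
  round_factors ms r p <= \prod_(2 <= t < r.+1) (1 - 2 / t%:R * (1 - p)).
Proof.
move=> p0 p1; pose D r := \prod_(2 <= t < r.+1) (1 - 2 / t%:R * (1 - p)).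
have D0 t : 0 <= D t.
  rewrite /D big_nat_cond; apply: prodr_ge0 => j /andP[/andP[j2 _] _].
  by have := @round_factor_ge0 1 j p p0; rewrite muln1; apply=> //; lra.
have split1 m t : (2 * m <= t)%N -> (0 < t)%N ->
    (1 - (2 * m)%:R / t%:R * (1 - p)) * D (t - m)%N <= D t.
  move=> mt t0; elim: m mt => [_|m IH mt].
    by rewrite muln0 mul0r mul0r subr0 mul1r subn0.
  apply: le_trans (IH _); last by lia.
  have -> : (t - m = (t - m.+1).+1)%N by lia.
  rewrite [D _.+1]/D big_nat_recr /=; last by lia.
  rewrite -/(D _) mulrCA mulrC ler_wpM2l //.
  have -> : (t - m.+1).+1%:R = t%:R - m%:R :> R.
    by rewrite -natrB; [congr _%:R; lia|lia].
  rewrite !natrM -[m.+1]addn1 natrD.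
  have t0' : 0 < t%:R :> R by rewrite ltr0n.
  have tm : 0 < t%:R - m%:R :> R by rewrite subr_gt0 ltr_nat; lia.
  rewrite -subr_ge0 (_ : _ - _ =
    (2 * (1 - p)) * m%:R * (1 - 2 * p) / (t%:R * (t%:R - m%:R))).
    apply: divr_ge0; first by rewrite !mulr_ge0 ?ler0n ?subr_ge0 //; lra.
    by apply: mulr_ge0; apply: ltW.
  by field; rewrite !gt_eqF.
rewrite -/(D r); elim: ms r => [|m ms IH] r r0 /=.
  by move=> _ sm; rewrite /D (_ : r = 1%N) ?big_geq //; lia.
move=> /andP[mr wf] sm; apply: le_trans (split1 _ _ mr r0).
apply: ler_wpM2l; first by apply: round_factor_ge0 => //; lra.
by apply: IH => //; lia.
Qed.

(** For p = 1/2 the factor of a round is the ratio (r - m) / r of the numbers of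
    players after and before it, so the product telescopes. *)
Lemma round_factors_half ms r : (0 < r)%N -> feasible r ms ->
  sumn ms = (r - 1)%N -> round_factors ms r (1 / 2) = 1 / r%:R.
Proof.
elim: ms r => [|m ms IH] r r0 /=.
  by move=> _ sm; rewrite (_ : r = 1%N) ?divr1 //; lia.
move=> /andP[mr wf] sm; rewrite IH //; [|lia|lia].
have t0' : r%:R != 0 :> R by rewrite pnatr_eq0 -lt0n.
have tm : r%:R - m%:R != 0 :> R by rewrite subr_eq0 eqr_nat; lia.
rewrite natrB; last by lia.
by rewrite natrM; field; rewrite t0' tm.
Qed.

(** With r = 2^s + k, the bound (1 - 2k/r (1 - p)) p^s is the value of the format with k
    matches first, then 2^(s-1), 2^(s-2), ..., 1.  A round of m matches followed
    by this optimum is compared with the optimum itself.  If m <= k, it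
    amounts to splitting the first round of k matches in two, which decreases
    the product for p >= 1/2.  If m > k, it replaces the pair of rounds
    (k, 2^(s-1)) by the pair (m, 2^(s-1) + k - m): both leave 2^(s-1) players,
    and among pairs of rounds with a given total reduction the product is largest
    when one of them is a full round, where half of the players leave. *)
Lemma round_factors_le_pow2 ms s k p : 1 / 2 <= p -> p <= 1 ->
  (k < 2 ^ s)%N -> feasible (2 ^ s + k) ms -> sumn ms = (2 ^ s + k - 1)%N ->
  round_factors ms (2 ^ s + k) p <=
  (1 - (2 * k)%:R / (2 ^ s + k)%:R * (1 - p)) * p ^+ s.
Proof.
move=> p0 p1; elim: ms s k => [|m ms IH] s k ks /=.
  move=> _ sm; have pow0 := expn_gt0 2 s; have k0 : k = 0%N by lia.
  case: s ks sm pow0 => [|s] ks sm pow0; last first.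
    by have := expn_gt0 2 s; rewrite expnS in sm; lia.
  by rewrite k0 expr0 muln0 mulr0n !mul0r subr0 mulr1.
move=> /andP[mr wf] sm.
have r0 : 0 < (2 ^ s + k)%:R :> R by rewrite ltr0n; have := expn_gt0 2 s; lia.
have fac0 : 0 <= 1 - (2 * m)%:R / (2 ^ s + k)%:R * (1 - p).
  by apply: round_factor_ge0 => //; lra.
have [mk|km] := leqP m k.
  have rE : (2 ^ s + k - m = 2 ^ s + (k - m))%N by lia.
  rewrite rE in wf *.
  have /(_ wf) le := IH s (k - m)%N (leq_ltn_trans (leq_subr _ _) ks).
  apply: le_trans (ler_wpM2l fac0 (le _)) _; first by lia.
  rewrite mulrA ler_wpM2r ?exprn_ge0 //; first by lra.
  have r0' : 0 < (2 ^ s + k)%:R - m%:R :> R.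
    by rewrite subr_gt0 ltr_nat; have := expn_gt0 2 s; lia.
  rewrite -rE !natrM !natrB ?(leq_trans mk (leq_addl _ _)) //.
  have mk' : m%:R <= k%:R :> R by rewrite ler_nat.
  move: r0 r0' mk'; set r := (2 ^ s + k)%:R => r0 r0' mk'.
  rewrite -subr_ge0 (_ : _ - _ =
    (2 * (1 - p)) * m%:R * (k%:R - m%:R) * (2 * p - 1) / (r * (r - m%:R))).
    apply: divr_ge0; first by rewrite !mulr_ge0 ?ler0n ?subr_ge0 //; lra.
    by apply: mulr_ge0; apply: ltW.
  by field; rewrite -natrD !gt_eqF.
case: s ks mr wf sm r0 fac0 => [|s] ks mr wf sm r0 fac0; first by lia.
have pow := expnS 2 s.
have rE : (2 ^ s.+1 + k - m = 2 ^ s + (2 ^ s + k - m))%N by lia.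
rewrite rE in wf *; have le := IH s (2 ^ s + k - m)%N.
apply: le_trans (ler_wpM2l fac0 (le _ wf _)) _; [lia|lia|].
rewrite exprS !mulrA ler_wpM2r ?exprn_ge0 //; first by lra.
have mr' : 0 <= 2 * (2 ^ s)%:R + k%:R - 2 * m%:R :> R.
  by rewrite subr_ge0 -!natrM -natrD ler_nat; lia.
have km' : 0 <= m%:R - k%:R :> R by rewrite subr_ge0 ler_nat ltnW.
have rm : 0 < 2 * (2 ^ s)%:R + k%:R - m%:R :> R.
  by rewrite subr_gt0 -natrM -natrD ltr_nat; lia.
rewrite -rE pow natrB; last by lia.
rewrite !natrM natrB; last by lia.
rewrite (natrD _ (2 ^ s)) (natrD _ (2 * 2 ^ s)) natrM.
rewrite pow natrD natrM in r0.
move: r0 mr' km' rm; move: (2 ^ s)%:R k%:R m%:R => P K M r0 mr' km' rm.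
rewrite -subr_ge0 (_ : _ - _ = (1 - p) * (2 * p - 1) *
  (2 * P + K - 2 * M) * (M - K) / ((2 * P + K) * (2 * P + K - M))).
  apply: divr_ge0; first by rewrite !mulr_ge0 ?subr_ge0 //; lra.
  by apply: mulr_ge0; apply: ltW.
by field; rewrite !gt_eqF.
Qed.

End Formats.

(** * Replacing match results by fair coins *)

Section Round.
Variables (R : realType) (n : nat) (v : 'I_n -> R).
Hypothesis v_gt0 : forall j, 0 < v j.
Implicit Types (i a c l : 'I_n) (A B D S X Y : {set 'I_n}) (s : {perm 'I_n}).
Local Notation beat := (beat_pr v).

Lemma beat_ge0 a c : 0 <= beat a c.
Proof. by apply: divr_ge0; rewrite ?addr_ge0 // ltW. Qed.

Lemma beatC a c : beat c a = 1 - beat a c.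
Proof.
rewrite /beat_pr (addrC (v c)); have : v a + v c != 0 by rewrite gt_eqF ?addr_gt0.
by move=> ?; field.
Qed.

(** Of two players, the one that i beats more easily is the weaker, hence beats the
    other with probability at most 1/2. *)
Lemma beat_sub_half i a c :
  (beat i a - beat i c) * (beat a c - 1 / 2) <= 0.
Proof.
have [[va vc] vi] := (v_gt0 a, v_gt0 c, v_gt0 i).
have -> : (beat i a - beat i c) * (beat a c - 1 / 2) =
  - (v i * (v a - v c) ^+ 2 / (2 * (v i + v a) * (v i + v c) * (v a + v c))).
  rewrite /beat_pr.
  have ? : v i + v a != 0 by rewrite gt_eqF ?addr_gt0.
  have ? : v i + v c != 0 by rewrite gt_eqF ?addr_gt0.
  have ? : v a + v c != 0 by rewrite gt_eqF ?addr_gt0.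
  by field; apply/and3P.
rewrite oppr_le0; apply: divr_ge0; first by rewrite mulr_ge0 ?sqr_ge0 ?ltW.
by rewrite ltW // !mulr_gt0 ?addr_gt0.
Qed.

(** Chebyshev's argument for one match: pairing s with its composition with the
    transposition of the two slots, the difference of the two sides is half the
    sum of the products in the hypothesis. *)
Lemma sum_beat_le_half Y (G : {set {perm 'I_n}}) a c (W : {perm 'I_n} -> R) :
  swap_closed Y G -> a \in Y -> c \in Y ->
  (forall s, (W s - W (tperm a c * s)%g) * (beat (s a) (s c) - 1 / 2) <= 0) ->
  \sum_(s in G) beat (s a) (s c) * W s <= 1 / 2 * \sum_(s in G) W s.
Proof.
move=> GY aY cY Wac.
have E : \sum_(s in G) beat (s a) (s c) * W s =
         \sum_(s in G) (1 - beat (s a) (s c)) * W (tperm a c * s)%g.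
  rewrite -(sum_swap _ GY aY cY); apply: eq_bigr => s _.
  by rewrite !permM tpermL tpermR beatC.
have : \sum_(s in G) (beat (s a) (s c) * W s +
          (1 - beat (s a) (s c)) * W (tperm a c * s)%g) <=
        \sum_(s in G) (W s + W (tperm a c * s)%g) / 2.
  apply: ler_sum => s _; have := Wac s; lra.
rewrite -mulr_suml !big_split /= (sum_swap W GY aY cY) -E; lra.
Qed.

(** The matches are removed one at a time.  The slots being distinct, the factors
    of the other matches are invariant under the exchange of the two slots of the
    match at hand; the product over D changes only if its winning slot is in D
    (the losing one is not), and then its variation is controlled by
    [beat_sub_half]. *)
Lemma sum_beats_le Y (G : {set {perm 'I_n}}) (I : finType) (P : pred I)
    (f : I * bool -> 'I_n) (w : I -> bool) i D :
  swap_closed Y G -> injective f ->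
  (forall j, P j -> forall b, f (j, b) \in Y) ->
  (forall j, P j -> f (j, ~~ w j) \notin D) ->
  \sum_(s in G) (\prod_(j | P j) beat (s (f (j, w j))) (s (f (j, ~~ w j)))) *
     \prod_(l in D) beat i (s l) <=
  (\prod_(j | P j) (1 / 2)) * \sum_(s in G) \prod_(l in D) beat i (s l).
Proof.
move=> GY f_inj fY fD.
have : uniq (index_enum I) by exact: index_enum_uniq.
elim: (index_enum I) => [_|j0 js IH /= /andP[j0js /IH le_js]].
  rewrite big_nil mul1r le_eqVlt; apply/orP; left; apply/eqP.
  by apply: eq_bigr => s _; rewrite big_nil mul1r.
rewrite big_cons; under eq_bigr do rewrite big_cons.
have [Pj0|//] := boolP (P j0).
under eq_bigr do rewrite -mulrA.
rewrite -[leRHS]mulrA.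
have half_gt0 : 0 < 1 / 2 :> R by rewrite divr_gt0.
rewrite -(ler_pM2l half_gt0) in le_js; apply: le_trans le_js.
apply: sum_beat_le_half GY _ _ _ => [||s]; [exact: fY|exact: fY|].
set a := f (j0, w j0); set c := f (j0, ~~ w j0).
pose Q s := \prod_(j <- js | P j) beat (s (f (j, w j))) (s (f (j, ~~ w j))).
have Q0 : 0 <= Q s by apply: prodr_ge0 => j _; apply: beat_ge0.
have QE : Q (tperm a c * s)%g = Q s.
  rewrite /Q big_seq_cond [RHS]big_seq_cond; apply: eq_bigr => j /andP[jjs _].
  have dj b b' : f (j0, b) != f (j, b').
    by apply: contraNneq j0js => /f_inj [-> _].
  by rewrite !permM !tpermD; try exact: dj.
rewrite -/(Q s) -/(Q _) QE -mulrBr -mulrA mulr_ge0_le0 //.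
have cD : c \notin D := fD _ Pj0.
have [aD|aD] := boolP (a \in D); last first.
  rewrite (_ : \prod_(l in D) beat i ((tperm a c * s)%g l) =
               \prod_(l in D) beat i (s l)) ?subrr ?mul0r //.
  apply: eq_bigr => l lD; rewrite permM tpermD //.
    by apply: contraNneq aD => ->.
  by apply: contraNneq cD => ->.
rewrite !(big_setD1 a aD) /= permM tpermL.
rewrite (_ : \prod_(l in D :\ a) beat i ((tperm a c * s)%g l) =
             \prod_(l in D :\ a) beat i (s l)); last first.
  apply: eq_bigr => l; rewrite !inE => /andP[la lD].
  rewrite permM tpermD //; first by rewrite eq_sym.
  by apply: contraNneq cD => ->.
rewrite -mulrBl mulrAC mulr_le0_ge0 ?beat_sub_half //.
by apply: prodr_ge0 => l _; apply: beat_ge0.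
Qed.

(** * One round with a fixed pairing *)

Lemma perm_imsetD1 s X a :
  [set s l | l in X :\ a] = [set s l | l in X] :\ s a.
Proof.
apply/setP => l; rewrite -(permKV s l) mem_imset; last exact: perm_inj.
by rewrite !inE (inj_eq perm_inj) mem_imset //; apply: perm_inj.
Qed.

(** Reading s as the assignment of a player to each slot, player i sits in slot a. *)
Definition stab_at A a i : {set {perm 'I_n}} := [set s in stab A | s a == i].

Lemma stab_at_swap A a i : swap_closed (A :\ a) (stab_at A a i).
Proof.
move=> b c s; rewrite !inE => /andP[ba bA] /andP[ca cA] /andP[sA /eqP <-].
rewrite permM tpermD // eqxx andbT.
by have := stab_swap bA cA (_ : s \in stab A); rewrite !inE; apply.
Qed.

Lemma stab_at_imset A a i s :
  s \in stab_at A a i -> [set s l | l in A :\ a] = A :\ i.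
Proof.
by rewrite inE => /andP[sA /eqP <-]; rewrite perm_imsetD1 stabP.
Qed.

Lemma card_stab_at A a i : a \in A -> i \in A ->
  #|A|%:R * #|stab_at A a i|%:R = #|stab A|%:R :> R.
Proof.
move=> aA iA.
have cE c : #|stab_at A c i|%:R = \sum_(s in stab A) (s c == i)%:R :> R.
  rewrite -sum1_card natr_sum [RHS]big_mkcond [LHS]big_mkcond.
  by apply: eq_bigr => s _; rewrite inE; case: (s \in stab A); case: eqP.
have E c : c \in A -> #|stab_at A c i|%:R = #|stab_at A a i|%:R :> R.
  move=> cA; rewrite !cE -(sum_swap _ (@stab_swap _ A) aA cA).
  by apply: eq_bigr => s _; rewrite permM tpermR.
rewrite mulr_natl -sumr_const; under eq_bigr => c cA do rewrite -(E c cA) cE.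
rewrite exchange_big /= -[RHS]mulr1 mulr_natl -sumr_const; apply: eq_bigr => s sA.
rewrite (bigD1 (s^-1 i)%g) /= ?permKV ?eqxx ?big1 ?addr0 //.
  by move=> c /andP[_ /negPf nc]; rewrite -(inj_eq (@perm_inj _ s^-1)) permK nc.
by rewrite -(stab_mem _ sA) permKV.
Qed.

(** The chance that i wins its next d matches when their opponents form a uniform
    d-subset of the other players alive; it counts as 0 once i is eliminated. *)
Definition surv_mean i d A : R :=
  (i \in A)%:R * elem_mean (beat i) d (A :\ i).

Section OneMatching.
Variables (m : nat) (A : {set 'I_n}) (i : 'I_n) (d : nat).
Variables (f : {ffun 'I_m * bool -> 'I_n}) (w : {ffun 'I_m -> bool}).
Hypotheses (iA : i \in A) (f_inj : injective f) (fA : forall q, f q \in A).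

Let losers := [set f (j, ~~ w j) | j : 'I_m].
Let winners := [set f (j, w j) | j : 'I_m].
Let beats (P : pred 'I_m) (s : {perm 'I_n}) :=
  \prod_(j | P j) beat (s (f (j, w j))) (s (f (j, ~~ w j))).

Let card_losers : #|losers| = m.
Proof. by rewrite card_imset ?card_ord // => j j' /f_inj[]. Qed.

Let card_winners : #|winners| = m.
Proof. by rewrite card_imset ?card_ord // => j j' /f_inj[]. Qed.

Let losersA : losers \subset A.
Proof. by apply/subsetP => _ /imsetP[j _ ->]. Qed.

Let winnersAL : winners \subset A :\: losers.
Proof.
apply/subsetP => _ /imsetP[j _ ->]; rewrite inE fA andbT.
by apply/imsetP => -[j' _ /f_inj[-> /eqP]]; case: (w j').
Qed.

Lemma card_after_round : #|A :\: losers| = (#|A| - m)%N.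
Proof. by rewrite cardsD (setIidPr losersA) card_losers. Qed.

Lemma matches_le_card : (2 * m <= #|A|)%N.
Proof.
have := subset_leq_card winnersAL; rewrite card_after_round card_winners.
by have := subset_leq_card losersA; rewrite card_losers; lia.
Qed.

(** Player i sits in a slot a that does not play: every match is turned into a fair
    coin. *)
Lemma bye_le a D : a \in A -> a \notin losers -> a \notin winners ->
  D \subset (A :\: losers) :\ a -> #|D| = d ->
  \sum_(s in stab_at A a i) beats xpredT s * \prod_(l in D) beat i (s l) <=
  (1 / 2) ^+ m * (#|stab_at A a i|%:R * elem_mean (beat i) d (A :\ i)).
Proof.
move=> aA aL aW DS cD.
have DA : D \subset A :\ a by rewrite (subset_trans DS) // setSD // subsetDl.
rewrite -cD -(sum_prod_perm _ (@stab_at_swap A a i) (@stab_at_imset A a i) DA).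
have := @sum_beats_le _ _ _ xpredT f w i D (@stab_at_swap A a i) f_inj.
rewrite prodr_const cardT size_enum_ord; apply=> j _.
  move=> b; rewrite !inE fA andbT.
  have [->|/eqP bw] := eqVneq b (w j).
    by apply: contraNneq aW => <-; apply: imset_f.
  have -> : b = ~~ w j by case: b (w j) bw => [] [].
  by apply: contraNneq aL => <-; apply/imsetP; exists j.
apply/negP => /(subsetP DS); rewrite !inE => /and3P[_ /negP[]].
by apply/imsetP; exists j.
Qed.

(** Player i sits in the winning slot of a match: the factor of this match is x at
    the player in the losing slot c, which therefore joins D, and only the m - 1
    other matches yield a factor 1/2. *)
Lemma winner_le a D : a \in winners ->
  D \subset (A :\: losers) :\ a -> #|D| = d ->
  \sum_(s in stab_at A a i) beats xpredT s * \prod_(l in D) beat i (s l) <=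
  2 * (1 / 2) ^+ m * (#|stab_at A a i|%:R * elem_mean (beat i) d.+1 (A :\ i)).
Proof.
move=> /imsetP[j0 _ aE] DS cD.
set c := f (j0, ~~ w j0).
have DA : D \subset A :\ a by rewrite (subset_trans DS) // setSD // subsetDl.
have LD j : f (j, ~~ w j) \notin D.
  apply/negP => /(subsetP DS); rewrite !inE => /and3P[_ /negP[]].
  by apply/imsetP; exists j.
have ca : c != a by rewrite aE; apply/eqP => /f_inj[/eqP]; case: (w j0).
have cDA : c |: D \subset A :\ a by rewrite subUset sub1set DA andbT !inE ca fA.
have ccD : #|c |: D| = d.+1 by rewrite cardsU1 LD cD.
rewrite -ccD -(sum_prod_perm _ (@stab_at_swap A a i) (@stab_at_imset A a i) cDA).
have := @sum_beats_le _ _ _ (predC1 j0) f w i (c |: D) (@stab_at_swap A a i) f_inj.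
rewrite prodr_const cardC1 card_ord => le.
rewrite [leLHS](eq_bigr (fun s : {perm 'I_n} => 
   beats (predC1 j0) s * \prod_(l in c |: D) beat i (s l))); last first.
  move=> s; rewrite inE => /andP[_ /eqP sa]; rewrite /beats (bigD1 j0) //=.
  by rewrite -aE sa big_setU1 ?LD //= -/c; ring.
have -> : 2 * (1 / 2) ^+ m = (1 / 2) ^+ m.-1 :> R.
  have m0 : (0 < m)%N := leq_ltn_trans (leq0n _) (ltn_ord j0).
  by rewrite -{1}(prednK m0) exprS; lra.
apply: le => j jj0.
  move=> b; rewrite !inE fA andbT aE.
  by apply: contraNneq jj0 => /f_inj[->].
rewrite in_setU1 negb_or LD andbT.
by apply: contraNneq jj0 => /f_inj[->].
Qed.

(** The permutations are sorted by the slot a of player i: nothing if a is a losing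
    slot, [winner_le] for the m winning slots and [bye_le] for the #|A| - 2m slots
    that do not play.  Each slot receives the same number N of permutations. *)
Lemma sum_stab_round_le :
  \sum_(s in stab A) beats xpredT s * surv_mean i d [set s l | l in A :\: losers]
  <= #|stab A|%:R * (1 / 2) ^+ m *
     ((1 - (2 * m)%:R / #|A|%:R) * elem_mean (beat i) d (A :\ i) +
      (2 * m)%:R / #|A|%:R * elem_mean (beat i) d.+1 (A :\ i)).
Proof.
set Z := elem_mean _ d _; set Z' := elem_mean _ d.+1 _.
have Z0 : 0 <= Z by apply: elem_mean_ge0 => l; apply: beat_ge0.
have Z'0 : 0 <= Z' by apply: elem_mean_ge0 => l; apply: beat_ge0.
pose N : R := #|stab_at A i i|%:R.
have N0 : 0 <= N by apply: ler0n.
have A0 : #|A|%:R != 0 :> R by rewrite pnatr_eq0 -lt0n; apply/card_gt0P; exists i.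
have NE a : a \in A -> #|stab_at A a i|%:R = N.
  by move=> aA; apply: (mulfI A0); rewrite !card_stab_at.
set B := A :\: losers.
have half0 : 0 <= (1 / 2) ^+ m :> R by rewrite exprn_ge0 // divr_ge0.
have E : \sum_(s in stab A) beats xpredT s * surv_mean i d [set s l | l in B] =
   \sum_(a in B) \sum_(s in stab_at A a i)
      beats xpredT s * elem_mean (fun l => beat i (s l)) d (B :\ a).
  rewrite (exchange_big_dep (mem (stab A))) /=; last first.
    by move=> a s _; rewrite inE => /andP[].
  apply: eq_bigr => s sA; set a := (s^-1 i)%g.
  have sa : s a = i by rewrite permKV.
  rewrite /surv_mean -{1 3}sa mem_imset; last exact: perm_inj.
  rewrite -perm_imsetD1 elem_mean_imset.
  rewrite [RHS](eq_bigl (fun c => (c \in B) && (c == a))); last first.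
    by move=> c; rewrite [s \in _]in_set sA -{1}sa (inj_eq perm_inj).
  have [aB|aB] := boolP (a \in B).
    rewrite (big_pred1 a) ?mul1r // => c /=.
    by case: eqP => [->|]; rewrite ?aB ?andbF.
  rewrite big1 ?mul0r ?mulr0 // => c /andP[cB /eqP ca].
  by rewrite -ca cB in aB.
have slot a : a \in B -> \sum_(s in stab_at A a i)
      beats xpredT s * elem_mean (fun l => beat i (s l)) d (B :\ a) <=
    if a \in winners then 2 * (1 / 2) ^+ m * (N * Z') else (1 / 2) ^+ m * (N * Z).
  move=> aB; have /setDP[aA aL] := aB.
  under eq_bigr do rewrite /elem_mean mulrA mulr_sumr.
  rewrite -mulr_suml exchange_big /=; apply: elem_average_le.
    have twohalf0 := mulr_ge0 (ler0n R 2) half0.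
    by case: ifP => _; apply: mulr_ge0 => //; apply: mulr_ge0.
  move=> D DB cD; rewrite -(NE a aA); case: ifP => [aW|/negbT aW].
    exact: winner_le.
  exact: bye_le.
rewrite E; apply: le_trans (ler_sum _ slot) _.
rewrite (bigID (mem winners)) /=.
rewrite (eq_bigr (fun=> 2 * (1 / 2) ^+ m * (N * Z'))); last by move=> a /andP[_ ->].
rewrite [X in _ + X](eq_bigr (fun=> (1 / 2) ^+ m * (N * Z))); last first.
  by move=> a /andP[_ /negPf->].
rewrite !sumr_const.
have -> : #|(fun a => (a \in B) && (a \in winners))| = m.
  rewrite -[RHS]card_winners -[in RHS](setIidPr winnersAL).
  by apply: eq_card => a; rewrite in_setI.
have -> : #|(fun a => (a \in B) && (a \notin winners))| = (#|A| - 2 * m)%N.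
  transitivity #|B :\: winners|.
    by apply: eq_card => a; rewrite in_setD andbC.
  by rewrite cardsD (setIidPr winnersAL) card_winners card_after_round; lia.
rewrite -(card_stab_at iA iA) -/N -[_ *+ m]mulr_natl -[_ *+ (_ - _)]mulr_natl.
rewrite natrB ?matches_le_card //.
rewrite natrM le_eqVlt; apply/orP; left; apply/eqP.
move: Z Z' N (_ ^+ m) #|A|%:R m%:R A0 {Z0 Z'0 N0 half0 NE E slot} => Z Z' N h a b a0.
by field.
Qed.

End OneMatching.

(** * Averaging over the pairing *)

Lemma uniform_ge0 (T : finType) (D : {set T}) (q : T) : 0 <= uniform_pr R D q.
Proof. by rewrite /uniform_pr; case: ifP => _; rewrite ?invr_ge0 ?ler0n. Qed.

Lemma uniform_mean_le (T : finType) (D : {set T}) (h : T -> R) (K : R) :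
  0 <= K -> (forall q, q \in D -> h q <= K) ->
  \sum_(q : T) uniform_pr R D q * h q <= K.
Proof.
move=> K0 hK; rewrite (bigID (mem D)) /= [X in _ + X]big1 ?addr0; last first.
  by move=> q /negPf qD; rewrite /uniform_pr qD mul0r.
rewrite (eq_bigr (fun q => (#|D|%:R)^-1 * h q)); last first.
  by move=> q qD; rewrite /uniform_pr qD.
have [D0|D0] := eqVneq #|D| 0%N.
  by rewrite big1 // => q; rewrite (cards0_eq D0) inE.
rewrite -mulr_sumr ler_pdivrMl ?ltr0n ?lt0n // mulr_natl -sumr_const.
exact: ler_sum.
Qed.

Lemma round_sum m A (F : {set 'I_n} -> R) :
  \sum_(B : {set 'I_n}) round_pr v m A B * F B =
  \sum_(S : {set 'I_n}) uniform_pr R (selections m A) S *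
    \sum_(f : {ffun 'I_m * bool -> 'I_n}) uniform_pr R (arrangements m S) f *
      \sum_(w : {ffun 'I_m -> bool}) outcome_pr v f w * F (survivors A f w).
Proof.
rewrite /round_pr; under eq_bigr do rewrite mulr_suml.
rewrite exchange_big; apply: eq_bigr => S _ /=.
under eq_bigr do rewrite -mulrA mulr_suml.
rewrite -mulr_sumr exchange_big /=; congr (_ * _); apply: eq_bigr => f _.
under eq_bigr do rewrite -mulrA mulr_suml.
rewrite -mulr_sumr (exchange_big_dep xpredT) //=; congr (_ * _).
by apply: eq_bigr => w _; rewrite (big_pred1 (survivors A f w)) // => B; rewrite eq_sym.
Qed.

Definition permf m s (f : {ffun 'I_m * bool -> 'I_n}) :
  {ffun 'I_m * bool -> 'I_n} := [ffun q => s (f q)].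

Lemma permfK m s : cancel (@permf m s) (permf s^-1).
Proof. by move=> f; apply/ffunP => q; rewrite !ffunE permK. Qed.

Lemma imset_permK s S : [set (s^-1)%g l | l in [set s l | l in S]] = S.
Proof.
by rewrite -imset_comp -[RHS]imset_id; apply: eq_imset => l /=; rewrite permK.
Qed.

Lemma imset_perm_inj s : injective (fun S => [set s l | l in S]).
Proof.
exact: (can_inj (g := fun S => [set (s^-1)%g l | l in S]) (imset_permK s)).
Qed.

Lemma uniform_imset (T : finType) (g : T -> T) (D D' : {set T}) (q : T) :
  injective g -> D' = [set g q | q in D] ->
  uniform_pr R D' (g q) = uniform_pr R D q.
Proof. by move=> gI ->; rewrite /uniform_pr mem_imset // card_imset. Qed.

Lemma selections_perm m A s : s \in stab A ->
  selections m A = [set [set s l | l in S] | S : {set 'I_n} in selections m A].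
Proof.
move=> sA; apply/setP => S; have sI : injective s by exact: perm_inj.
rewrite -{2}(imset_permK s^-1%g S) invgK mem_imset; last first.
  exact: imset_perm_inj.
rewrite !inE (card_imset _ (@perm_inj _ _)); congr (_ && _).
apply/idP/idP => /subsetP h; apply/subsetP => l.
  by case/imsetP => k kS ->; rewrite -(stab_mem _ sA) permKV h.
by move=> lS; rewrite -(permKV s l) (stab_mem _ sA) h // imset_f.
Qed.

Lemma arrangements_perm m S s :
  arrangements m [set s l | l in S] = [set permf s f | f in arrangements m S].
Proof.
apply/setP => f; rewrite -{2}(permfK s^-1%g f) invgK mem_imset; last first.
  exact: can_inj (@permfK m s).
rewrite !inE; have fE : f =1 s \o permf s^-1%g f.
  by move=> q; rewrite /= ffunE permKV.
congr (_ && _).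
  apply/injectiveP/injectiveP => fI q q'.
    by rewrite !ffunE => /perm_inj/fI.
  by rewrite !fE /= => /perm_inj/fI.
rewrite (eq_imset _ fE) imset_comp.
exact: (inj_eq (@imset_perm_inj s)).
Qed.

Lemma survivors_perm m A s f w : s \in stab A ->
  survivors A (@permf m s f) w = [set s l | l in survivors A f w].
Proof.
move=> sA; rewrite /survivors; apply/setP => l.
rewrite -(permKV s l) mem_imset; last exact: perm_inj.
rewrite !in_setD (stab_mem _ sA); congr (~~ _ && _).
apply/imsetP/imsetP => -[j _ E]; exists j => //.
  by move: E; rewrite ffunE => /perm_inj.
by rewrite ffunE -E.
Qed.

(** The selection and the arrangement are uniform on sets that relabelling by s
    permutes. *)
Lemma round_mean_symm m A s (h : {ffun 'I_m * bool -> 'I_n} -> R) :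
  s \in stab A ->
  \sum_(S : {set 'I_n}) uniform_pr R (selections m A) S *
    \sum_(f : {ffun 'I_m * bool -> 'I_n}) uniform_pr R (arrangements m S) f *
      h f =
  \sum_(S : {set 'I_n}) uniform_pr R (selections m A) S *
    \sum_(f : {ffun 'I_m * bool -> 'I_n}) uniform_pr R (arrangements m S) f *
      h (permf s f).
Proof.
move=> sA; have sI := @imset_perm_inj s; have fI := can_inj (@permfK m s).
rewrite (reindex_inj sI) /=; apply: eq_bigr => S _.
rewrite (uniform_imset _ sI (selections_perm m sA)); congr (_ * _).
rewrite (reindex_inj fI) /=; apply: eq_bigr => f _.
by rewrite (uniform_imset _ fI (arrangements_perm m S s)).
Qed.

Lemma surv_mean_ge0 i d A : 0 <= surv_mean i d A.
Proof.
rewrite mulr_ge0 ?ler0n //; apply: elem_mean_ge0 => l; exact: beat_ge0.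
Qed.

(** By [round_mean_symm] the mean over the pairings f equals its average over the
    relabellings of f by s; for fixed f and fixed winning sides w,
    [sum_stab_round_le] bounds this average, and its factor (1/2)^m cancels the
    sum over the 2^m choices of w. *)
Lemma round_surv_mean_le m A i d : (2 * m <= #|A|)%N ->
  \sum_(B : {set 'I_n}) round_pr v m A B * surv_mean i d B <=
  (1 - (2 * m)%:R / #|A|%:R) * surv_mean i d A +
  (2 * m)%:R / #|A|%:R * surv_mean i d.+1 A.
Proof.
move=> mA; rewrite round_sum.
have [iA|iA] := boolP (i \in A); last first.
  rewrite /surv_mean (negPf iA) !mul0r !mulr0 addr0 big1 // => S _.
  rewrite big1 ?mulr0 // => f _; rewrite big1 ?mulr0 // => w _.
  by rewrite /survivors in_setD (negPf iA) andbF mul0r mulr0.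
set Z := _ + _.
have A0 : 0 < #|A|%:R :> R by rewrite ltr0n; apply/card_gt0P; exists i.
have Z0 : 0 <= Z.
  apply: addr_ge0; apply: mulr_ge0; rewrite ?surv_mean_ge0 //.
    by rewrite subr_ge0 ler_pdivrMr // mul1r ler_nat.
  by rewrite divr_ge0 ?ler0n.
have G0 : 0 < #|stab A|%:R :> R by rewrite ltr0n card_stab_gt0.
rewrite -(ler_pM2l G0) mulr_natl -sumr_const.
under eq_bigr => s sA do rewrite (round_mean_symm _ sA).
rewrite exchange_big /=; under eq_bigr do rewrite -mulr_sumr.
have GZ0 := mulr_ge0 (ltW G0) Z0.
apply: uniform_mean_le => // S; rewrite inE => /andP[SA _].
rewrite exchange_big /=; under eq_bigr do rewrite -mulr_sumr.
apply: uniform_mean_le => // f; rewrite inE => /andP[/injectiveP fI /eqP fS].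
have fA q : f q \in A by rewrite (subsetP SA) // -fS imset_f.
rewrite exchange_big /=.
apply: le_trans (_ : \sum_(w : {ffun 'I_m -> bool})
                       #|stab A|%:R * (1 / 2) ^+ m * Z <= _).
  apply: ler_sum => w _; have := sum_stab_round_le d w iA fI fA.
  rewrite /Z /surv_mean iA !mul1r; apply: le_trans.
  rewrite le_eqVlt; apply/orP; left; apply/eqP; apply: eq_bigr => s sA.
  rewrite survivors_perm //; congr (_ * _).
  by apply: eq_bigr => j _; rewrite !ffunE.
rewrite sumr_const card_ffun card_bool card_ord -[leLHS]mulr_natl natrX -!mulrA mulrCA.
rewrite (mulrA (2 ^+ m)) -exprMn mul1r divff ?pnatr_eq0 // expr1n mul1r.
exact: lexx.
Qed.

Lemma round_card m A B :
  round_pr v m A B != 0 -> #|B| = (#|A| - m)%N.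
Proof.
apply: contra_neq_eq => cB; rewrite /round_pr big1 // => S _.
have [SA|/negPf SA] := boolP (S \in selections m A); last first.
  by rewrite /uniform_pr SA mul0r.
rewrite big1 ?mulr0 // => f _.
have [fS|/negPf fS] := boolP (f \in arrangements m S); last first.
  by rewrite /uniform_pr fS mul0r.
rewrite big_pred0 ?mulr0 // => w; apply: contraNF cB => /eqP <-.
move: SA fS; rewrite !inE => /andP[SA _] /andP[/injectiveP fI /eqP fS].
rewrite /survivors (card_after_round w fI) // => q.
by rewrite (subsetP SA) // -fS imset_f.
Qed.

Lemma outcome_ge0 m f w : 0 <= outcome_pr v (m := m) f w.
Proof. by apply: prodr_ge0 => j _; apply: beat_ge0. Qed.

Lemma round_ge0 m A B : 0 <= round_pr v m A B.
Proof.
apply: sumr_ge0 => S _; apply: mulr_ge0; first exact: uniform_ge0.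
apply: sumr_ge0 => f _; apply: mulr_ge0; first exact: uniform_ge0.
by apply: sumr_ge0 => w _; apply: outcome_ge0.
Qed.

(** * Iterating over the rounds *)

(** The mean of g at the number of matches of a player who never loses. *)
Fixpoint match_mean (ms : seq nat) (r : nat) (g : nat -> R) : R :=
  if ms is m :: ms' then
    (1 - (2 * m)%:R / r%:R) * match_mean ms' (r - m) g +
    (2 * m)%:R / r%:R * match_mean ms' (r - m) (fun d => g d.+1)
  else g 0%N.

Lemma match_mean_le ms r (g g' : nat -> R) : feasible r ms ->
  (forall d, g d <= g' d) -> match_mean ms r g <= match_mean ms r g'.
Proof.
elim: ms r g g' => [|m ms IH] r g g' /=; first by [].
move=> /andP[mr wf] gg'; apply: lerD; apply: ler_wpM2l.
- exact: play_pr_le1.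
- exact: IH.
- exact: play_pr_ge0.
- by apply: IH.
Qed.

Lemma match_mean_lin ms r (a c : R) (g g' : nat -> R) :
  match_mean ms r (fun d => a * g d + c * g' d) =
  a * match_mean ms r g + c * match_mean ms r g'.
Proof.
elim: ms r g g' => [//|m ms IH] r g g' /=; rewrite !IH; ring.
Qed.

Lemma match_mean_sum ms r (I : finType) (p : I -> R) (g : I -> nat -> R) :
  match_mean ms r (fun d => \sum_q p q * g q d) =
  \sum_q p q * match_mean ms r (g q).
Proof.
elim: ms r g => [//|m ms IH] r g /=; rewrite !IH !mulr_sumr -big_split /=.
by apply: eq_bigr => q _; ring.
Qed.

(** Induction on the rounds: [match_mean] is linear and monotone in its function
    argument, so the expectation over the first round passes inside, where
    [round_surv_mean_le] applies. *)
Lemma win_from_le ms A i : feasible #|A| ms ->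
  win_from v ms A i <= match_mean ms #|A| (fun d => surv_mean i d A).
Proof.
elim: ms A => [|m ms IH] A /=.
  move=> _; case: eqP => [->|_]; last exact: surv_mean_ge0.
  by rewrite /surv_mean inE eqxx elem_mean0 mulr1.
move=> /andP[mA wf].
apply: le_trans (_ : \sum_B round_pr v m A B *
   match_mean ms (#|A| - m) (fun d => surv_mean i d B) <= _).
  apply: ler_sum => B _; have [->|nz] := eqVneq (round_pr v m A B) 0.
    by rewrite !mul0r.
  rewrite ler_wpM2l ?round_ge0 //.
  by rewrite -(round_card nz) IH // (round_card nz).
rewrite -match_mean_sum -match_mean_lin; apply: match_mean_le => // d.
exact: round_surv_mean_le.
Qed.

(** The exponent d counts the matches already played, since the recursion shifts g
    after each of them. *)
Lemma match_mean_exp ms r p d :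
  match_mean ms r (fun e => p ^+ (d + e)) = p ^+ d * round_factors ms r p.
Proof.
elim: ms r d => [|m ms IH] r d /=; first by rewrite addn0 mulr1.
rewrite IH (_ : match_mean _ _ _ = p ^+ d.+1 * round_factors ms (r - m) p).
  by rewrite exprS; ring.
rewrite -IH; congr match_mean.
by apply: boolp.funext => e; rewrite addnS.
Qed.

Lemma win_from_le_factors ms A i : i \in A -> feasible #|A| ms ->
  win_from v ms A i <=
  round_factors ms #|A| (elem_mean (beat i) 1 (A :\ i)).
Proof.
move=> iA wf; apply: le_trans (win_from_le i wf) _.
rewrite -[leRHS]mul1r -(expr0 (elem_mean (beat i) 1 (A :\ i))) -match_mean_exp.
apply: match_mean_le => // d; rewrite /surv_mean iA mul1r add0n.
apply: elem_mean_le_exp => l; exact: beat_ge0.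
Qed.

End Round.

(** * The bound on the winning probability *)

Lemma feasible_format n ms : is_format n ms -> feasible n ms.
Proof.
case=> _ _ _; elim: ms n => [//|m ms IH] n le2 /=; apply/andP; split.
  by have := le2 0%N isT; rewrite /= subn0.
by apply: IH => s lts; have := le2 s.+1 lts; rewrite /= subnDA.
Qed.

Theorem theorem7 (R : realType) (n s k : nat) (v : 'I_n -> R)
    (v_gt0 : forall i, 0 < v i)
    (s_ge1 : (1 <= s)%N) (k_lt : (k < 2 ^ s)%N) (n_eq : n = (2 ^ s + k)%N)
    (ms : seq nat) (ms_format : is_format n ms) (i : 'I_n) :
  let p := mean_beat_pr v i in
  win_pr v ms i <=
    if 1 / 2 < p then
      ((2 * k)%:R / n%:R * p + 1 - (2 * k)%:R / n%:R) * p ^+ s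
    else if p == 1 / 2 then
      1 / n%:R
    else
      \prod_(1 <= j < n)
        (2 / (n - j + 1)%:R * p + 1 - 2 / (n - j + 1)%:R).
Proof.
cbv zeta; set p := mean_beat_pr v i.
have wf := feasible_format ms_format.
have [_ _ sum_ms _] := ms_format.
have n_ge2 : (2 <= n)%N.
  by rewrite n_eq; case: (s) s_ge1 => // t _; rewrite expnS; have := expn_gt0 2 t; lia.
have n0 : (0 < n)%N := ltnW n_ge2.
have card_opp : #|[set: 'I_n] :\ i| = (n - 1)%N.
  by rewrite cardsDS ?subsetT // cards1 cardsT card_ord.
have pE : p = elem_mean (beat_pr v i) 1 (setT :\ i).
  rewrite elem_mean1 card_opp /p /mean_beat_pr mul1r mulrC; congr (_ / _).
  by apply: eq_bigl => j; rewrite !inE andbT.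
have p_ge0 : 0 <= p by rewrite pE elem_mean_ge0 // => l; apply: beat_ge0.
have p_le1 : p <= 1.
  rewrite pE elem_mean1 card_opp ler_pdivrMr ?ltr0n ?subn_gt0 // mul1r.
  rewrite -card_opp -sumr_const; apply: ler_sum => l _.
  by rewrite /beat_pr ler_pdivrMr ?addr_gt0 // mul1r lerDl ltW.
have win_le : win_pr v ms i <= round_factors ms n p.
  have := @win_from_le_factors R n v v_gt0 ms setT i.
  by rewrite inE cardsT card_ord -pE; apply.
apply: (le_trans win_le); case: ltP => [p_gt|p_le].
  have := @round_factors_le_pow2 R ms s k p; rewrite -n_eq => le_pow2.
  apply: le_trans (le_pow2 (ltW p_gt) p_le1 k_lt wf sum_ms) _.
  by rewrite le_eqVlt; apply/orP; left; apply/eqP; ring.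
case: eqP => [p_half|_]; first by rewrite p_half round_factors_half.
apply: le_trans (round_factors_le_single p_ge0 p_le n0 wf sum_ms) _.
rewrite le_eqVlt; apply/orP; left; apply/eqP.
(* Reindexing by t = n - j + 1, the number of players before the j-th match. *)
rewrite [RHS]big_nat_rev (big_addn 1 n.+1 1) /=.
rewrite subn1 /=; apply: eq_big_nat => j /andP[j1 jn].
have -> : (n - (1 + n - j.+1) + 1 = j + 1)%N by lia.
by ring.
Qed.
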